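(* Let $p$ be a prime with $p\mid F_{p-1}$, and for $n\ge1$ let $R_n$ be the $n\times n$ matrix with $(i,j)$ entry $\binom{i-1}{n-j}$. Then $R_n^{\,p-1}\equiv I_n\pmod p$ for every $n\ge 1$.
   Context: Convention: $\binom{m}{k}=0$ if $k<0$ or $k>m$. The Fibonacci sequence is $F_0=0$, $F_1=1$, $F_{m+1}=F_m+F_{m-1}$. Matrix congruences modulo $p$ are entrywise; $I_n$ is the identity matrix. *)

(* Defs.v *)
From mathcomp Require Import all_boot all_order all_algebra.

Set Implicit Arguments.
Unset Strict Implicit.
Unset Printing Implicit Defensive.

Fixpoint fib (m : nat) : nat :=
  match m with
  | 0 => 0
  | 1 => 1
  | (k.+1 as k').+1 => fib k' + fib k
  end.

(* With 1-based indices i' = i.+1 and j' = j.+1 the entry is 'C(i' - 1, n - j').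
   Since j < n, the subtraction n - j.+1 is never truncated. *)
Definition binom_mx (n : nat) : 'M[int]_n :=
  (\matrix_(i < n, j < n) ('C(i, n - j.+1))%:Z)%R.

Definition eqmx_mod (p : nat) (m n : nat) (A B : 'M[int]_(m, n)) : Prop :=
  forall i j, (A i j = B i j %[mod p])%Z.

(* Main.v *)
(** For indeterminates x, y let e(x, y) be the column of the monomials
    x^(n-1-j) y^j.  By the binomial theorem R_n e(x, y) = e(y, x + y), so that
    R_n^k e(x, y) = e(F_(k-1) x + F_k y, F_k x + F_(k+1) y).  For k = p - 1 and
    p | F_(p-1), the right-hand side is e(c x, c y) modulo p, with c = F_p.
    Moreover c = 1 modulo p: if Q^2 = Q + 1, then (1 - Q)^2 = (1 - Q) + 1,
    hence Q^p = c Q and (1 - Q)^p = c (1 - Q), and the Frobenius identity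
    1 = (Q + (1 - Q))^p = Q^p + (1 - Q)^p gives 1 = c.  Comparing coefficients
    in R_n^(p-1) e(1, X) = e(1, X) yields the congruence. *)
Require Import Defs.
From mathcomp Require Import all_boot all_order all_algebra.
From mathcomp Require Import ring.

Import GRing.Theory.
Section Fibonacci.

Local Open Scope ring_scope.

Lemma fibSS k : fib k.+2 = (fib k.+1 + fib k)%N.
Proof. by []. Qed.

Lemma expr_fib (R : pzRingType) (x : R) k :
  x ^+ 2 = x + 1 -> x ^+ k.+1 = x *+ fib k.+1 + (fib k)%:R.
Proof.
move=> x2; elim: k => [|k IHk]; first by rewrite expr1 addr0.
rewrite exprS IHk mulrDr !mulrnAr mulr1 -expr2 x2 mulrnDl fibSS mulrnDr.
by rewrite addrAC.
Qed.

(** [R] may be noncommutative, so that [Q] can be a matrix; Frobenius is additive here because [Q]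
    commutes with [1 - Q]. *)
Lemma natr_fib_prime (R : nzRingType) (p : nat) (Q : R) :
  p \in [pchar R] -> Q ^+ 2 = Q + 1 -> (p %| fib (p - 1))%N ->
  (fib p)%:R = 1 :> R.
Proof.
move=> pcharR Q2 p_dvd.
have p_gt0 : (0 < p)%N by rewrite prime_gt0 // (pcharf_prime pcharR).
have fib0 : (fib p.-1)%:R = 0 :> R.
  by apply/eqP; rewrite -(dvdn_pcharf pcharR) -subn1.
have exp_p (x : R) : x ^+ 2 = x + 1 -> x ^+ p = x *+ fib p.
  by move=> x2; rewrite -{1}(prednK p_gt0) expr_fib // fib0 addr0 prednK.
have Q2' : (1 - Q) ^+ 2 = 1 - Q + 1.
  rewrite expr2 mulrBr mulr1 mulrBl mul1r -expr2 Q2.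
  by rewrite [Q + 1]addrC opprB addrK.
have comQ : GRing.comm Q (1 - Q) by rewrite /GRing.comm mulrBl mulrBr mul1r mulr1.
have := pFrobenius_autD_comm pcharR comQ.
by rewrite !pFrobenius_autE (exp_p Q) // (exp_p (1 - Q)) // -mulrnDl [Q + _]addrC subrK expr1n.
Qed.

(** The Fibonacci matrix with rows (0, 1) and (1, 1): a root of [x ^+ 2 = x + 1] over any [R], so
    none has to be found in ['F_p] itself. *)
Definition fib_mx (R : nzRingType) : 'M[R]_2 :=
  \matrix_(i, j) ((0 < i + j)%N)%:R.

Lemma fib_mx_sqr (R : nzRingType) : fib_mx R ^+ 2 = fib_mx R + 1.
Proof.
apply/matrixP=> i j; rewrite expr2 !mxE !big_ord_recl big_ord0 !mxE.
case: i j => [[|[|//]] ?] [[|[|//]] ?];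
  by rewrite /= ?mulr0 ?mul0r ?mulr1 ?addr0 ?add0r.
Qed.

Lemma Fp_fib_prime (p : nat) :
  prime p -> (p %| fib (p - 1))%N -> (fib p)%:R = 1 :> 'F_p.
Proof.
move=> p_prime; have pcharM : p \in [pchar 'M['F_p]_2].
  by rewrite pchar_lalg pchar_Fp.
move=> /(natr_fib_prime _ _ _ pcharM (fib_mx_sqr _)) /matrixP /(_ 0 0).
by rewrite -scaler_nat !mxE mulr1.
Qed.

Definition monom_col {S : comNzRingType} (n : nat) (x y : S) : 'cV[S]_n :=
  \col_j (x ^+ (n - j.+1) * y ^+ j).

Lemma binom_mx_monom (S : comNzRingType) (n : nat) (x y : S) :
  map_mx intr (binom_mx n) *m monom_col n x y = monom_col n y (x + y).
Proof.
apply/matrixP=> i j; rewrite !mxE.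
rewrite (reindex_inj rev_ord_inj) /= addrC exprDn mulr_sumr.
pose F k : S := y ^+ (n - i.+1) * (y ^+ (i - k) * x ^+ k *+ 'C(i, k)).
(* The binomial sum over k <= i is padded to k < n; the extra terms match ['C(i, k) = 0]. *)
rewrite (big_ord_widen n F (ltn_ord i)) [RHS]big_mkcond /=.
apply: eq_bigr => k _; rewrite !mxE /= subnSK // (subKn (ltnW (ltn_ord k))).
case: ltnP => [lt_ki|lt_ik]; last by rewrite bin_small // mul0r.
rewrite /F mulrnAr mulrA -exprD addnBA // addnBAC ?ltn_ord //.
rewrite (subnS (n + i) i) addnK -subn1 -subnDA add1n.
by rewrite -pmulrn mulr_natl [x ^+ k * _]mulrC.
Qed.

Lemma binom_mxX_monom (S : comNzRingType) (n k : nat) (x y : S) :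
  map_mx intr (binom_mx n ^+ k.+1) *m monom_col n x y =
  monom_col n (x *+ fib k + y *+ fib k.+1) (x *+ fib k.+1 + y *+ fib k.+2).
Proof.
elim: k x y => [|k IHk] x y.
  by rewrite expr1 binom_mx_monom mulr0n add0r !mulr1n.
(* The rightmost factor acts first, so the induction hypothesis is used at (y, x + y). *)
rewrite exprSr -mulmxE map_mxM -mulmxA binom_mx_monom IHk.
congr monom_col; rewrite ?fibSS ?mulrnDl ?mulrnDr; ring.
Qed.

End Fibonacci.

Theorem theorem11 (p : nat) (p_prime : prime p) (p_dvd_fib : p %| fib (p - 1)) :
  forall n : nat, 1 <= n -> eqmx_mod p (binom_mx n ^+ (p - 1))%R (1%:M)%R.
Proof.
move=> n _ i j.
pose S := {poly 'F_p}.
have pcharS : p \in [pchar S]%R by rewrite pchar_poly pchar_Fp.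
have fib_p : ((fib p)%:R = 1 :> S)%R.
  by rewrite -polyC_natr Fp_fib_prime.
have /(congr1 (fun A : 'cV[S]_n => (A i 0%R)`_j)%R) :
    (map_mx intr (binom_mx n ^+ (p - 1)) *m monom_col n 1 'X
     = monom_col n 1 'X :> 'cV[S]_n)%R.
  case: p p_prime p_dvd_fib @S pcharS fib_p => [|[|k]] // _ dvd S pcharS fib_p.
  have fib0 : ((fib k.+1)%:R = 0 :> S)%R.
    by apply/eqP; rewrite -(dvdn_pcharf pcharS); rewrite subn1 in dvd.
  (* Here p = k + 2, so [fib k] is F_(p-2) = F_p - F_(p-1). *)
  have fib1 : ((fib k)%:R = 1 :> S)%R by move: fib_p; rewrite fibSS natrD fib0 add0r.
  rewrite subn1 binom_mxX_monom -[('X *+ fib k.+1)%R]mulr_natr.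
  by rewrite -[('X *+ fib k.+2)%R]mulr_natr fib0 fib1 fib_p mulr0 addr0 add0r mulr1.
(* Row [i] of the product is a polynomial whose coefficient at ['X^j] is the matrix entry (i, j)
   modulo p. *)
rewrite /= !mxE coef_sum (bigD1 j) //= big1 => [|k neq_kj].
  rewrite !mxE !expr1n !mul1r addr0 -polyCMz coefCM !coefXn eqxx mulr1 => entry.
  apply/eqP; rewrite eqz_mod_dvd (dvdz_pcharf (pchar_Fp p_prime)) rmorphB /=.
  by rewrite entry (eq_sym (j : nat)) val_eqE; case: (i == j); rewrite subrr.
rewrite !mxE expr1n mul1r -polyCMz coefCM coefXn.
by rewrite eq_sym (inj_eq val_inj) (negPf neq_kj) mulr0.
Qed.
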